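(* Let $M=\langle M,\ast,e,\le\rangle$ be a $\wedge$-smooth pre-Riesz monoid and let $x\in M$. If $x$ is expressible as $x=h_{1}\ast\cdots\ast h_{r}$, with finitely many homogeneous elements $h_1,\dots,h_r$, then $x$ is expressible, uniquely up to permutation of the factors, as $x=H_1\ast\cdots\ast H_n$ with $H_1,\dots,H_n$ mutually disjoint homogeneous elements of $M$.
   Context: A monoid is a commutative semigroup with identity $e$. A partially ordered (p.o.) monoid has a partial order $\le$ with $x\le y\Rightarrow z\ast x\le z\ast y$; it is directed if any two elements have a common upper bound and a common lower bound. A pre-Riesz monoid is a directed p.o. monoid $M$ with least element $e$ (so $M=M^+=\{m: m\ge e\}$) such that for any $x_1,\dots,x_n\in M\setminus\{e\}$ either $\mathrm{glb}(x_1,\dots,x_n)=e$ or there is $r\in M$ with $e<r\le x_1,\dots,x_n$. $x\wedge y$ denotes the greatest lower bound when it exists. $M$ is $\wedge$-smooth if whenever $x\wedge y$ exists one has $z\ast(x\wedge y)=(z\ast x)\wedge(z\ast y)$ for all $z\in M$ (so the right side exists), and whenever $x\wedge(y\wedge z)$ or $(x\wedge y)\wedge z$ exists one has $x\wedge(y\wedge z)=(x\wedge y)\wedge z$ (so both sides exist). Elements $x,y$ are disjoint if $x\wedge y=e$, i.e. $z\le x,y$ implies $z\le e$; mutually disjoint means pairwise disjoint. An element $h\in M$ is homogeneous if $h>e$ and for all $u,v\in M$ with $e<u,v\le h$ there is $l\in M$ with $e<l\le u,v$. *)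

(* Defs.v *)
From mathcomp Require Import all_boot all_order.
From mathcomp Require Import boolp classical_sets.

Set Implicit Arguments.
Unset Strict Implicit.
Unset Printing Implicit Defensive.

Import Order.TTheory.
Local Open Scope classical_set_scope.
Local Open Scope order_scope.

Section PreRieszMonoid.
Context {d : Order.disp_t} {M : porderType d} {e : M}.
Variable op : Monoid.com_law e.

(* The greatest lower bound is a partial operation, so it is handled
   relationally: [is_meet x y m] reads "x /\ y exists and is equal to m". *)
Definition is_meet (x y m : M) : Prop := infimums [set x; y] m.

Definition po_monoid : Prop :=
  forall x y z : M, x <= y -> op z x <= op z y.

Definition directed : Prop :=
  forall x y : M, (exists u, x <= u /\ y <= u) /\ (exists l, l <= x /\ l <= y).

Record pre_riesz_monoid : Prop := PreRieszMonoid {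
  pre_riesz_po : po_monoid;
  pre_riesz_directed : directed;
  pre_riesz_least : forall x : M, e <= x;
  pre_riesz_glb : forall s : seq M, s != [::] -> e \notin s ->
    infimums [set` s] e \/ exists r : M, e < r /\ forall x, x \in s -> r <= x
}.

(* In [meet_smoothA] each side says that the iterated meet exists, inner meet
   included, and equals m; hence the equivalence says that if one of the two
   iterated meets exists then so does the other, with the same value. *)
Record meet_smooth : Prop := MeetSmooth {
  meet_smoothM : forall x y m : M, is_meet x y m ->
    forall z, is_meet (op z x) (op z y) (op z m);
  meet_smoothA : forall x y z m : M,
    (exists a, is_meet y z a /\ is_meet x a m) <->
    (exists b, is_meet x y b /\ is_meet b z m)
}.

End PreRieszMonoid.

Section Elements.
Context {d : Order.disp_t} {M : porderType d}.
Variable e : M.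

Definition disjoint_elts (x y : M) : Prop := is_meet x y e.

(* Disjointness is required between distinct positions of the list, so a
   repeated factor must be disjoint from itself. *)
Definition mutually_disjoint (s : seq M) : Prop :=
  forall i j, (i < size s)%N -> (j < size s)%N -> i != j ->
    disjoint_elts (nth e s i) (nth e s j).

Definition homogeneous (h : M) : Prop :=
  e < h /\ forall u v : M, e < u -> u <= h -> e < v -> v <= h ->
    exists l : M, [/\ e < l, l <= u & l <= v].

End Elements.

Section Products.
Context {d : Order.disp_t} {M : porderType d} {e : M}.
Variable op : Monoid.com_law e.

Definition homogeneous_product (x : M) (s : seq M) : Prop :=
  (forall h, h \in s -> homogeneous e h) /\ x = \big[op/e]_(h <- s) h.

End Products.

(* Main.v *)
Require Import Defs.
From mathcomp Require Import all_boot all_order.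
From mathcomp Require Import boolp classical_sets.

(** Call two elements overlapping when they have a common lower bound other
    than [e]; since [e] is the least element, this is the failure of
    disjointness.  Homogeneity of [h] says that any two nontrivial elements
    below [h] overlap, so overlapping is transitive through a homogeneous
    element ([overlap_trans]).

    Smoothness enters through one observation: if [u] and [k] are disjoint,
    translating their meet [e] by [h] shows that [h] is the meet of
    [op h u] and [op h k].  Two consequences carry the proof.

    - An element disjoint from [h] and from [k] is disjoint from [op h k]
      ([disjoint_op]).  Hence anything nontrivial below [op h k] overlaps [h]
      or [k], and if [h] and [k] are overlapping homogeneous elements, then
      [op h k] is homogeneous ([homogeneous_op]).  Merging overlapping factors
      of a product of homogeneous elements therefore terminates, in a product
      of mutually disjoint ones.

    - An element below [op h k] and disjoint from [k] is below [h]
      ([le_op_disjoint]).  This replaces cancellation in the proof of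
      uniqueness: let two mutually disjoint factorizations of [x] be given.  A
      factor [h] of the first lies below [x], hence overlaps some factor [k]
      of the second; by transitivity, [h] is disjoint from all the other
      factors of the second, so [h <= k].  By symmetry [k <= h], so both
      factorizations have the same factors, and a factor cannot be repeated
      because it is not disjoint from itself. *)

Set Implicit Arguments.
Unset Strict Implicit.
Unset Printing Implicit Defensive.

Import Order.TTheory.
Local Open Scope classical_set_scope.
Local Open Scope order_scope.

Lemma is_meetP (d : Order.disp_t) (M : porderType d) (x y m : M) :
  is_meet x y m <->
  [/\ m <= x, m <= y & forall z, z <= x -> z <= y -> z <= m].
Proof.
split=> [[lbm ubm]|[mx my ubm]].
  split; [by apply: lbm; left | by apply: lbm; right | ].
  by move=> z zx zy; apply: ubm => w [] ->.
split; first by move=> w [] ->.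
by move=> z lbz; apply: ubm; apply: lbz; [left | right].
Qed.

Section LeastElement.
Context {d : Order.disp_t} {M : porderType d} (e : M).
Context (e_least : forall x : M, e <= x).

Definition overlap (x y : M) : Prop := exists r : M, [/\ e < r, r <= x & r <= y].

Lemma overlap_sym x y : overlap x y -> overlap y x.
Proof. by case=> r [r0 rx ry]; exists r. Qed.

Lemma overlap_le x y y' : y <= y' -> overlap x y -> overlap x y'.
Proof. by move=> yy' [r [r0 rx ry]]; exists r; split=> //; apply: le_trans yy'. Qed.

Lemma overlap_refl x : e < x -> overlap x x.
Proof. by exists x. Qed.

Lemma disjointNoverlap x y : disjoint_elts e x y <-> ~ overlap x y.
Proof.
split=> [/is_meetP[_ _ glb] [r [r0 rx ry]]|Nxy].
  by have := lt_le_trans r0 (glb r rx ry); rewrite ltxx.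
apply/is_meetP; split=> // z zx zy.
have [-> // | z_neq_e] := eqVneq z e.
by case: Nxy; exists z; rewrite lt_neqAle eq_sym z_neq_e e_least.
Qed.

(** The two witnesses of overlap both lie below [h], so homogeneity provides a
    nontrivial element below both of them. *)
Lemma overlap_trans h x y :
  homogeneous e h -> overlap x h -> overlap h y -> overlap x y.
Proof.
move=> [_ hom_h] [r [r0 rx rh]] [s [s0 sh sy]].
have [l [l0 lr ls]] := hom_h _ _ r0 rh s0 sh.
by exists l; split=> //; [apply: le_trans rx | apply: le_trans sy].
Qed.

Lemma mutually_disjoint_mem s h k :
  mutually_disjoint e s -> h \in s -> k \in s -> overlap h k -> h = k.
Proof.
move=> disj hs ks hk; apply: contrapT => h_neq_k.
have : disjoint_elts e h k.
  rewrite -(nth_index e hs) -(nth_index e ks); apply: disj; rewrite ?index_mem //.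
  apply/eqP => eq_index; apply: h_neq_k.
  by rewrite -(nth_index e hs) eq_index nth_index.
by move/disjointNoverlap.
Qed.

Lemma mutually_disjoint_uniq s :
  mutually_disjoint e s -> (forall h, h \in s -> e < h) -> uniq s.
Proof.
move=> disj pos; apply/(uniqP e) => i j; rewrite !inE => si sj eq_ij.
apply/eqP; apply: contrapT => /negP /(disj i j si sj).
rewrite -eq_ij => /disjointNoverlap; apply.
by apply: overlap_refl; apply: pos; apply: mem_nth.
Qed.

Lemma overlapping_pair s :
  ~ mutually_disjoint e s ->
  exists h k r, perm_eq s [:: h, k & r] /\ overlap h k.
Proof.
move=> Ndisj; apply: contrapT => Npair; apply: Ndisj => i j si sj i_neq_j.
apply/disjointNoverlap.
(* With [i < j], the second position survives in the suffix of [s] after [i],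
   so both factors can be extracted even when they are equal. *)
wlog i_lt_j : i j si sj i_neq_j / (i < j)%N => [th|ov].
  have [||eq_ij] := ltngtP i j; first exact: th.
    by move=> j_lt_i /overlap_sym; apply: th; rewrite // eq_sym.
  by rewrite eq_ij eqxx in i_neq_j.
have j_in : nth e s j \in drop i.+1 s.
  rewrite -(subnKC i_lt_j) -nth_drop mem_nth // size_drop.
  by rewrite ltn_sub2r // (leq_ltn_trans i_lt_j).
apply: Npair.
exists (nth e s i), (nth e s j), (take i s ++ rem (nth e s j) (drop i.+1 s)).
split=> //; rewrite -{1}(cat_take_drop i s) (drop_nth e si).
rewrite -cat1s perm_catCA perm_cons.
by rewrite -[_ :: _ ++ _]cat1s perm_sym perm_catCA perm_cat2l perm_sym perm_to_rem.
Qed.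

End LeastElement.

Section SmoothMonoid.
Context {d : Order.disp_t} {M : porderType d} {e : M} (op : Monoid.com_law e).
Context (e_least : forall x : M, e <= x) (op_mono : po_monoid op).
Context (smooth : meet_smooth op).

Lemma le_opl x y : x <= op x y.
Proof. by rewrite -{1}(Monoid.mulm1 op x); apply: op_mono. Qed.

Lemma le_big_op s h : h \in s -> h <= \big[op/e]_(k <- s) k.
Proof. by move=> hs; rewrite (perm_big _ (perm_to_rem hs)) big_cons le_opl. Qed.

(** Here [h = op h e], so this is the translate by [h] of the meet [e] of [u]
    and [k]. *)
Lemma is_meet_op_disjoint u h k :
  disjoint_elts e u k -> is_meet (op h u) (op h k) h.
Proof. by move/(meet_smoothM smooth)/(_ h); rewrite Monoid.mulm1. Qed.

(** Since [u] also lies below [op h u], it lies below the meet [h] of [op h u]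
    and [op h k]. *)
Lemma le_op_disjoint u h k : disjoint_elts e u k -> u <= op h k -> u <= h.
Proof.
move=> /(is_meet_op_disjoint h) /is_meetP[_ _ glb] u_le.
by apply: glb => //; rewrite Monoid.mulmC le_opl.
Qed.

(** With [h] the meet of [op h u] and [op h k], the meet [e] of [u] and [h] is
    an iterated meet of [u], [op h u] and [op h k]; reassociating and absorbing
    [op h u] into [u] gives the meet of [u] and [op h k]. *)
Lemma disjoint_op u h k :
  disjoint_elts e u h -> disjoint_elts e u k -> disjoint_elts e u (op h k).
Proof.
move=> uh /(is_meet_op_disjoint h) meet_h.
have [|b [/is_meetP[bu _ glb] meet_b]] :=
    (meet_smoothA smooth u (op h u) (op h k) e).1.
  by exists h.
suff -> : u = b by [].
by apply: le_anti; rewrite bu andbT glb // Monoid.mulmC le_opl.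
Qed.

Lemma overlap_op u h k :
  e < u -> u <= op h k -> overlap e u h \/ overlap e u k.
Proof.
move=> u0 u_le; apply: contrapT => /not_orP[].
move=> /(disjointNoverlap e_least) uh /(disjointNoverlap e_least) uk.
have /(disjointNoverlap e_least) := disjoint_op uh uk; apply.
by apply: overlap_le u_le _; apply: overlap_refl.
Qed.

(** Whatever overlaps [k] also overlaps [h], by transitivity through [k]; so
    every nontrivial element below [op h k] overlaps [h], and transitivity
    through [h] compares any two of them. *)
Lemma homogeneous_op h k :
  homogeneous e h -> homogeneous e k -> overlap e h k ->
  homogeneous e (op h k).
Proof.
move=> hom_h hom_k ov_hk.
split=> [|u v u0 u_le v0 v_le].
  by case: hom_h => h0 _; apply: lt_le_trans h0 (le_opl h k).
have overlap_h w : e < w -> w <= op h k -> overlap e w h.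
  move=> w0 /(overlap_op w0)[] // wk.
  exact: overlap_trans hom_k wk (overlap_sym ov_hk).
exact: overlap_trans hom_h (overlap_h _ u0 u_le) (overlap_sym (overlap_h _ v0 v_le)).
Qed.

Lemma disjoint_big_op u s :
  (forall h, h \in s -> disjoint_elts e u h) ->
  disjoint_elts e u (\big[op/e]_(h <- s) h).
Proof.
elim: s => [_|h s IHs disj].
  by rewrite big_nil; apply/is_meetP; split.
rewrite big_cons; apply: disjoint_op; first by apply: disj; rewrite mem_head.
by apply: IHs => k ks; apply: disj; rewrite inE ks orbT.
Qed.

(** Induction on the number of factors: as long as two of them overlap, they
    can be replaced with their product, which is homogeneous. *)
Lemma mutually_disjoint_factorization s x :
  homogeneous_product op x s ->
  exists2 t, homogeneous_product op x t & mutually_disjoint e t.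
Proof.
have [n] := ubnP (size s); elim: n s => // n IHn s size_s [hom_s x_s].
have [|Ndisj] := pselect (mutually_disjoint e s); first by exists s.
have [h [k [r [perm_s ov_hk]]]] := overlapping_pair e_least Ndisj.
have hom f : f \in [:: h, k & r] -> homogeneous e f.
  by rewrite -(perm_mem perm_s); apply: hom_s.
apply: (IHn (op h k :: r)); first by rewrite (perm_size perm_s) in size_s.
split=> [f|]; last first.
  by rewrite x_s (perm_big _ perm_s) !big_cons Monoid.mulmA.
rewrite inE => /predU1P[->|fr]; last by apply: hom; rewrite !inE fr !orbT.
by apply: homogeneous_op => //; apply: hom; rewrite !inE eqxx ?orbT.
Qed.

(** By transitivity through [h], a factor of [s] overlapping [h] also overlaps
    [k], hence is [k] itself.  So [h] is disjoint from the product of the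
    factors other than [k], and that product can be dropped from [h <= x]. *)
Lemma factor_le_overlapping s x h k :
  homogeneous_product op x s -> mutually_disjoint e s ->
  homogeneous e h -> h <= x -> k \in s -> overlap e h k -> h <= k.
Proof.
move=> [hom_s x_s] disj_s hom_h h_le ks ov_hk.
have uniq_s : uniq s.
  by apply: (mutually_disjoint_uniq e_least disj_s) => f /hom_s[].
rewrite x_s (perm_big _ (perm_to_rem ks)) big_cons in h_le.
apply: le_op_disjoint h_le; apply: disjoint_big_op => f.
rewrite mem_rem_uniq // inE => /andP[/eqP f_neq_k fs].
apply/(disjointNoverlap e_least) => ov_hf; apply: f_neq_k.
apply: (mutually_disjoint_mem e_least disj_s) => //.
exact: overlap_trans hom_h (overlap_sym ov_hf) ov_hk.
Qed.

Lemma factor_mem s t x h :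
  homogeneous_product op x s -> mutually_disjoint e s ->
  homogeneous_product op x t -> mutually_disjoint e t ->
  h \in s -> h \in t.
Proof.
move=> prod_s disj_s prod_t disj_t hs.
have [[hom_s x_s] [hom_t x_t]] := (prod_s, prod_t).
have h_le : h <= x by rewrite x_s le_big_op.
have [k kt ov_hk] : exists2 k, k \in t & overlap e h k.
  apply: contrapT => Nov.
  have /(disjointNoverlap e_least) : disjoint_elts e h x.
    rewrite x_t; apply: disjoint_big_op => k kt.
    by apply/(disjointNoverlap e_least) => ov_hk; apply: Nov; exists k.
  apply; apply: overlap_le h_le _; apply: overlap_refl.
  by case: (hom_s h hs).
suff -> : h = k by [].
have k_le : k <= x by rewrite x_t le_big_op.
apply: le_anti; apply/andP; split.
  exact: (factor_le_overlapping prod_t disj_t (hom_s h hs)).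
exact: (factor_le_overlapping prod_s disj_s (hom_t k kt) _ hs (overlap_sym ov_hk)).
Qed.

Lemma mutually_disjoint_factorization_unique s t x :
  homogeneous_product op x s -> mutually_disjoint e s ->
  homogeneous_product op x t -> mutually_disjoint e t -> perm_eq s t.
Proof.
move=> prod_s disj_s prod_t disj_t.
apply: uniq_perm => [||h].
- by apply: (mutually_disjoint_uniq e_least disj_s) => h /prod_s.1[].
- by apply: (mutually_disjoint_uniq e_least disj_t) => h /prod_t.1[].
- by apply/idP/idP; [apply: (factor_mem prod_s) | apply: (factor_mem prod_t)].
Qed.

End SmoothMonoid.

Theorem theorem4p14 (d : Order.disp_t) (M : porderType d) (e : M)
    (op : Monoid.com_law e) (x : M) :
  pre_riesz_monoid op -> meet_smooth op ->
  (exists s : seq M, homogeneous_product op x s) ->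
  exists t : seq M,
    [/\ homogeneous_product op x t,
        mutually_disjoint e t
      & forall t' : seq M, homogeneous_product op x t' ->
          mutually_disjoint e t' -> perm_eq t t'].
Proof.
move=> [op_mono _ e_least _] smooth [s prod_s].
have [t prod_t disj_t] :=
  mutually_disjoint_factorization e_least op_mono smooth prod_s.
exists t; split=> // t'.
exact: mutually_disjoint_factorization_unique prod_t disj_t.
Qed.
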